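(* Let $G$ be a graph with bounded degree and let $w:\mathbb N\to(0,\infty)$ satisfy $\sum_{n=0}^\infty 1/w(n)<\infty$. Then almost surely the vertex-reinforced random walk on $G$ with weight $w$ visits only a finite number of sites.
   Context: Given a locally finite graph $G$ (each vertex having at least one neighbour), a weight $w:\mathbb N\to(0,\infty)$ and a starting vertex $X_0$, the vertex-reinforced random walk (VRRW) $(X_n)_{n\ge0}$ on $G$ with weight $w$ is the process with $$\mathbb P(X_{n+1}=y\mid\mathcal F_n)=\frac{w(Z_n(y))}{\sum_{z\sim X_n}w(Z_n(z))}\mathbf 1_{\{X_n\sim y\}},$$ where $\mathcal F_n=\sigma(X_k;k\le n)$, $Z_n(y)=\sum_{\ell=0}^n\mathbf 1_{\{X_\ell=y\}}$, and $x\sim y$ means that $x$ and $y$ are neighbours in $G$. *)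

(* Defs.v *)
From HB Require Import structures.
From mathcomp Require Import all_boot all_order all_algebra.
From mathcomp Require Import all_classical all_reals all_analysis.
Set Implicit Arguments. Unset Strict Implicit. Unset Printing Implicit Defensive.
Import Order.TTheory GRing.Theory Num.Theory.
Local Open Scope ring_scope.
Local Open Scope classical_set_scope.

Definition simple_graph (V : eqType) (nbr : V -> seq V) : Prop :=
  (forall x, uniq (nbr x)) /\
  (forall x, x \notin nbr x) /\
  (forall x y, (y \in nbr x) = (x \in nbr y)).

Definition no_isolated (V : eqType) (nbr : V -> seq V) : Prop :=
  forall x, nbr x != [::].

Definition bounded_degree (V : eqType) (nbr : V -> seq V) : Prop :=
  exists D : nat, forall x, (size (nbr x) <= D)%N.

Definition visits (V : eqType) (p : seq V) (y : V) : nat := count_mem y p.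

Definition vrrw_step (R : realType) (V : eqType) (nbr : V -> seq V)
    (w : nat -> R) (x0 : V) (p : seq V) (y : V) : R :=
  let x := last x0 p in
  if y \in nbr x then
    w (visits p y) / \sum_(z <- nbr x) w (visits p z)
  else 0.

Definition vrrw_path_prob (R : realType) (V : eqType) (nbr : V -> seq V)
    (w : nat -> R) (x0 : V) (xs : seq V) : R :=
  (head x0 xs == x0)%:R *
  \prod_(1 <= k < size xs) vrrw_step nbr w x0 (take k xs) (nth x0 xs k).

Definition is_VRRW (R : realType) (d : measure_display) (T : measurableType d)
    (P : probability T R) (V : eqType) (nbr : V -> seq V) (w : nat -> R)
    (x0 : V) (X : nat -> T -> V) : Prop :=
  (forall n x, measurable [set om | X n om = x]) /\
  (forall xs : seq V, xs != [::] ->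
     P [set om | forall k, (k < size xs)%N -> X k om = nth x0 xs k]
       = (vrrw_path_prob nbr w x0 xs)%:E).

(* Main.v *)
(* The expected number of visited vertices is bounded, by a Lyapunov function.
   Fix a large threshold L, call a vertex high once it has L visits, low before,
   and consider the discovery of a vertex y by a jump from x.
   - If x has a high neighbour, discoveries are rare: a jump from x to a given
     neighbour visited m times is w(m)/w(0) times more likely than one to a given
     unvisited neighbour, and every vertex has its (m+1)-st visit at most once, so
     the expected number of such discoveries is at most
     D w(0) (sum_{m >= L} 1/w(m)) times that of visited vertices.
   - If all other neighbours of x and y are low, then with a probability bounded
     below the walk bounces between x and y forever, as the product of the
     w(m)/(w(m) + W) is positive; so few discoveries are of this kind.
   - If only y has another high neighbour, then y itself makes discoveries of the
     first kind only, and each x discovers at most D such vertices y: a potential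
     counting the unvisited neighbours of the vertices without high neighbour
     compensates these discoveries. *)
Require Import Defs.
From HB Require Import structures.
From mathcomp Require Import all_boot all_order all_algebra.
From mathcomp Require Import all_classical all_reals all_analysis.
From mathcomp Require Import ring lra zify.
Import Order.TTheory GRing.Theory Num.Theory.
Import numFieldNormedType.Exports.
Local Open Scope ring_scope.
Local Open Scope classical_set_scope.

Lemma sumr_const_seq (M : nmodType) (I : Type) (r : seq I) (a : M) :
  \sum_(i <- r) a = a *+ size r.
Proof. by rewrite big_const_seq count_predT iter_addr_0. Qed.

(** * Visit counts and distinct vertices of a history *)

Section Histories.
Context {V : eqType}.
Implicit Types (p : seq V) (x y z v : V).

Lemma visits_rcons p y z : visits (rcons p y) z = (visits p z + (y == z))%N.
Proof. by rewrite /visits -cats1 count_cat /= addn0. Qed.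

Lemma visits_rcons_neq p y z : z != y -> visits (rcons p y) z = visits p z.
Proof. by rewrite eq_sym visits_rcons => /negPf ->; rewrite addn0. Qed.

Lemma visits0 p y : y \notin p -> visits p y = 0%N.
Proof. exact: count_memPn. Qed.

Lemma perm_undup_rcons p y :
  perm_eq (undup (rcons p y)) (if y \in p then undup p else y :: undup p).
Proof.
case: ifPn => yp; apply: uniq_perm; rewrite ?cons_uniq ?undup_uniq //.
- by move=> z; rewrite !mem_undup mem_rcons in_cons; case: eqVneq => // ->.
- by rewrite mem_undup yp.
- by move=> z; rewrite in_cons !mem_undup mem_rcons in_cons.
Qed.

Lemma size_undup_rcons p y :
  size (undup (rcons p y)) = (size (undup p) + (y \notin p))%N.
Proof.
rewrite (perm_size (perm_undup_rcons p y)).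
by case: ifPn => _ /=; rewrite ?addn0 ?addn1.
Qed.

Lemma last_in (x0 : V) p : p != [::] -> last x0 p \in p.
Proof. by case: p => //= a p _; exact: mem_last. Qed.

End Histories.

(** * The transition operator on functions of the history *)

Section Transition.
Context {R : realType} {V : eqType}.
Variables (nbr : V -> seq V) (w : nat -> R) (x0 : V).
Hypothesis w_gt0 : forall n, 0 < w n.
Hypothesis nbr_nnil : no_isolated nbr.
Implicit Types (p : seq V) (x y z v : V).

Local Notation step := (vrrw_step nbr w x0).

Definition total_weight p : R := \sum_(z <- nbr (last x0 p)) w (visits p z).

(** The conditional expectation of [f] one step later, given the history [p]. *)
Definition transition (f : seq V -> R) p : R :=
  \sum_(y <- nbr (last x0 p)) step p y * f (rcons p y).

Lemma total_weight_gt0 p : 0 < total_weight p.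
Proof.
rewrite /total_weight; have := nbr_nnil (last x0 p).
case: (nbr _) => // a s _; rewrite big_cons ltr_wpDr //.
by apply: sumr_ge0 => z _; exact: ltW.
Qed.

Lemma stepE p y : y \in nbr (last x0 p) ->
  step p y = w (visits p y) / total_weight p.
Proof. by rewrite /vrrw_step => ->. Qed.

Lemma step_ge0 p y : 0 <= step p y.
Proof.
rewrite /vrrw_step; case: ifP => // _.
by rewrite divr_ge0 // ?(ltW (total_weight_gt0 p)) // ltW.
Qed.

Lemma sum_step p : \sum_(y <- nbr (last x0 p)) step p y = 1.
Proof.
rewrite (eq_big_seq (fun y => w (visits p y) / total_weight p)); last first.
  by move=> y; exact: stepE.
by rewrite -mulr_suml divff // gt_eqF // total_weight_gt0.
Qed.

Lemma sum_step_cst p a : \sum_(y <- nbr (last x0 p)) step p y * a = a.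
Proof. by rewrite -mulr_suml sum_step mul1r. Qed.

Lemma ler_transition f g p : (forall q, q != [::] -> f q <= g q) ->
  transition f p <= transition g p.
Proof.
move=> fg; apply: ler_sum => y _; rewrite ler_wpM2l ?step_ge0 //.
by apply: fg; rewrite -size_eq0 size_rcons.
Qed.

Lemma ler_iter_transition n f g p : p != [::] ->
  (forall q, q != [::] -> f q <= g q) ->
  iter n transition f p <= iter n transition g p.
Proof.
move=> p0 fg; elim: n p p0 => [|n IH] p p0 /=; first exact: fg.
exact: ler_transition.
Qed.

(** The submartingale inequality: [transition] is monotone, so the one-step bound can be
    iterated. *)
Lemma iter_transition_sub n f p :
  (forall q, q != [::] -> f q <= transition f q) -> p != [::] ->
  f p <= iter n transition f p.
Proof.
move=> sf; elim: n p => [|n IH] p p0 //=.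
by apply: le_trans (sf p p0) _; apply: ler_transition.
Qed.

Lemma transition_affine a b c e (f g h : seq V -> R) p :
  transition (fun q => a * f q + b * g q + c * h q + e) p =
  a * transition f p + b * transition g p + c * transition h p + e.
Proof.
rewrite -[in RHS](sum_step_cst p e) /transition !mulr_sumr -!big_split /=.
by apply: eq_bigr => y _; ring.
Qed.

End Transition.

Section Lyapunov.
Context {R : realType} {V : eqType}.
Variables (nbr : V -> seq V) (w : nat -> R) (x0 : V) (D L : nat).
Hypothesis nbrG : simple_graph nbr.
Hypothesis nbr_nnil : no_isolated nbr.
Hypothesis nbrD : forall x, (size (nbr x) <= D)%N.
Hypothesis w_gt0 : forall n, 0 < w n.
Hypothesis w_cvg : cvgn (series (fun n => (w n)^-1)).
Hypothesis L_gt0 : (0 < L)%N.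
Implicit Types (p : seq V) (x y z v : V).

Local Notation step := (vrrw_step nbr w x0).
Local Notation total_weight := (total_weight nbr w x0).
Local Notation transition := (transition nbr w x0).

(** * Tails of the series of [1 / w n] *)

Definition tail n : R :=
  limn (series (fun n => (w n)^-1)) - series (fun n => (w n)^-1) n.

Lemma tail_ge0 n : 0 <= tail n.
Proof.
rewrite subr_ge0; apply: nondecreasing_cvgn_le => //.
by apply: nondecreasing_series => k _ _; rewrite invr_ge0 ltW.
Qed.

Lemma tailS n : tail n = (w n)^-1 + tail n.+1.
Proof. by rewrite /tail seriesEnat /= big_nat_recr //=; ring. Qed.

Lemma tail_le_tail0 n : tail n <= tail 0.
Proof.
elim: n => // n IH; apply: le_trans IH.
by rewrite [leRHS]tailS lerDr invr_ge0 ltW.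
Qed.

Lemma sum_winv_le n : \sum_(L <= m < n) (w m)^-1 <= tail L.
Proof.
case: (leqP L n) => [|/ltnW] Ln; last by rewrite big_geq // tail_ge0.
rewrite -[leLHS]addr0; suff -> : tail L = \sum_(L <= m < n) (w m)^-1 + tail n.
  by rewrite lerD2l tail_ge0.
rewrite -(subnKC Ln); elim: (n - L)%N => [|k IH].
  by rewrite addn0 big_geq // add0r.
by rewrite IH addnS big_nat_recr ?leq_addr //= tailS addrA.
Qed.

(** * Low neighbourhoods and the frontier potential *)

Definition low p v := all (fun z => visits p z < L)%N (nbr v).

Definition low_but u p v :=
  all (fun z => (z == u) || (visits p z < L)%N) (nbr v).

Definition frontier p : nat :=
  \sum_(v <- undup p | low p v) count (fun z => z \notin p) (nbr v).

Lemma low_low_but u p v : low p v -> low_but u p v.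
Proof. by apply: sub_all => z ->; rewrite orbT. Qed.

Lemma low_rcons p y v : low (rcons p y) v -> low p v.
Proof.
apply: sub_all => z; rewrite visits_rcons; apply: leq_ltn_trans.
exact: leq_addr.
Qed.

Lemma count_new_rcons p y v :
  (count (fun z => z \notin rcons p y) (nbr v)
    <= count (fun z => z \notin p) (nbr v))%N.
Proof.
by apply: sub_count => z; rewrite mem_rcons in_cons negb_or => /andP[].
Qed.

Lemma frontier_term_rcons p y v :
  ((if low (rcons p y) v then count (fun z => z \notin rcons p y) (nbr v)
    else 0) <=
  (if low p v then count (fun z => z \notin p) (nbr v) else 0))%N.
Proof.
by case: ifP => // /low_rcons ->; exact: count_new_rcons.
Qed.

(* The delicate case is the discovery of a vertex [y] having a much visited
   neighbour by a walker at [x] having none: [y] never enters the frontier,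
   and the contribution of [x] drops. *)
Lemma frontier_rcons p y : p != [::] -> y \in nbr (last x0 p) ->
  (size (undup (rcons p y)) + frontier (rcons p y) <=
   size (undup p) + frontier p + D.+1 *
   ((y \notin p) && (~~ low p (last x0 p) || low_but (last x0 p) p y)))%N.
Proof.
set x := last x0 p => p0 yx.
have xp : x \in undup p by rewrite mem_undup last_in.
rewrite size_undup_rcons /frontier (perm_big _ (perm_undup_rcons p y)) /=.
case: ifPn => yp /=.
  rewrite muln0 !addn0 leq_add2l big_mkcond [leqRHS]big_mkcond /=.
  by apply: leq_sum => v _; exact: frontier_term_rcons.
have cD : (count (fun z => z \notin rcons p y) (nbr y) <= D)%N.
  exact: leq_trans (count_size _ _) (nbrD y).
have le1 : (\sum_(v <- undup p | low (rcons p y) v)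
     count (fun z => z \notin rcons p y) (nbr v) <= frontier p)%N.
  rewrite /frontier big_mkcond [leqRHS]big_mkcond /=.
  by apply: leq_sum => v _; exact: frontier_term_rcons.
(* The cost [D.+1] is one for the new vertex and at most [D] for its own frontier term. *)
rewrite big_cons; case: (boolP (_ || _)) => [_|].
  rewrite muln1 -addnA -/(frontier p).
  by case: ifP => _; lia.
rewrite negb_or negbK => /andP[lx /allPn[z zy]].
rewrite negb_or -leqNgt => /andP[zx Lz].
have -> : low (rcons p y) y = false.
  apply/negbTE/allPn; exists z => //.
  by rewrite -leqNgt visits_rcons (leq_trans Lz) // leq_addr.
rewrite muln0 addn0 -addnA leq_add2l add1n.
rewrite big_mkcond [leqRHS]big_mkcond /=.
rewrite (bigD1_seq x) ?undup_uniq //= [leqRHS](bigD1_seq x) ?undup_uniq //=.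
rewrite -addSn; apply: leq_add; last first.
  by apply: leq_sum => v _; exact: frontier_term_rcons.
have cx (a : pred V) : count a (nbr x) = (a y + count a (rem y (nbr x)))%N.
  by rewrite (permP (perm_to_rem yx)).
rewrite lx !cx yp mem_rcons mem_head /= add1n ltnS.
case: ifP => // _; rewrite add0n; apply: sub_count => t.
by rewrite mem_rcons in_cons negb_or => /andP[].
Qed.

(** * The charge for visits beyond the threshold *)

(** A visit to [z] preceded by [m >= L] others is charged [1 / w m], so each vertex is charged at
    most [tail L] in all. *)
Definition excess p : R :=
  \sum_(z <- undup p) \sum_(L <= m < visits p z) (w m)^-1.

Lemma excess_le p : excess p <= tail L * (size (undup p))%:R.
Proof.
rewrite mulr_natr -sumr_const_seq; apply: ler_sum => z _.
exact: sum_winv_le.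
Qed.

Lemma excess_rcons p y : excess (rcons p y) =
  excess p + if (L <= visits p y)%N then (w (visits p y))^-1 else 0.
Proof.
rewrite /excess (perm_big _ (perm_undup_rcons p y)) /=.
case: ifPn => yp; last first.
  (* As [0 < L], a first visit is never charged. *)
  rewrite visits0 // leqNgt L_gt0 /= addr0 big_cons visits_rcons eqxx.
  rewrite visits0 // big_geq // add0r.
  apply: eq_big_seq => z; rewrite mem_undup => zp.
  by rewrite visits_rcons_neq //; apply: contraNneq yp => <-.
have yp' : y \in undup p by rewrite mem_undup.
rewrite (bigD1_seq y) ?undup_uniq //= [in RHS](bigD1_seq y) ?undup_uniq //=.
rewrite addrAC; congr (_ + _); last first.
  by apply: eq_bigr => z zy; rewrite visits_rcons_neq.
rewrite visits_rcons eqxx addn1; case: leqP => Ly.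
  by rewrite big_nat_recr.
by rewrite addr0 !big_geq // ltnW.
Qed.

(** * Trapping on an edge *)

(** Bounds the total weight of at most [D] low vertices; as [w] need not be monotone, the sum over
    [m < L] dominates each of their weights. *)
Definition barrier : R := D%:R * \sum_(m < L) w m.

(* [hold n] bounds from below the product of the [w m / (w m + barrier)] over
   [m >= n]: by [hold_step] it is a subsolution of its recursion. *)
Definition hold n : R := expR (- barrier * tail n).

Lemma barrier_ge0 : 0 <= barrier.
Proof. by rewrite mulr_ge0 // sumr_ge0 // => m _; exact: ltW. Qed.

Lemma hold_gt0 n : 0 < hold n.
Proof. exact: expR_gt0. Qed.

Lemma hold_le1 n : hold n <= 1.
Proof.
by rewrite -expR0 ler_expR mulNr oppr_le0 mulr_ge0 ?barrier_ge0 ?tail_ge0.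
Qed.

Lemma hold0_le n : hold 0 <= hold n.
Proof.
by rewrite ler_expR ler_wnM2l ?oppr_le0 ?barrier_ge0 // tail_le_tail0.
Qed.

(** This is [1 + t <= expR t] at [t = barrier / w n]. *)
Lemma hold_step n : hold n <= w n / (w n + barrier) * hold n.+1.
Proof.
have wn := w_gt0 n; have b0 := barrier_ge0.
have s0 : 0 < w n + barrier by lra.
rewrite /hold tailS mulrDr expRD ler_wpM2r ?expR_ge0 // mulNr expRN.
rewrite -[leRHS]invrK lef_pV2 ?posrE ?expR_gt0 ?invr_gt0 ?divr_gt0 //.
rewrite invf_div mulrDl divff ?gt_eqF //; exact: expR_ge1Dx.
Qed.

Definition prev p := last x0 (take (size p).-1 p).

(* Bounds from below the probability of alternating forever between the last
   two vertices of [p], and is [0] unless their other neighbours are all low. *)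
Definition trap p : R :=
  let x := last x0 p in let y := prev p in
  if [&& y \in p, y \in nbr x, low_but x p y & low_but y p x]
  then hold (visits p y) * hold (visits p x) else 0.

Lemma trap_ge0 p : 0 <= trap p.
Proof.
by rewrite /trap; case: ifP => // _; rewrite mulr_ge0 // ltW // hold_gt0.
Qed.

Lemma trap_le1 p : trap p <= 1.
Proof.
rewrite /trap; case: ifP => // _.
by rewrite mulr_ile1 ?hold_le1 // ltW // hold_gt0.
Qed.

Lemma nbr_irr x y : y \in nbr x -> y != x.
Proof. by move=> yx; apply: contraTneq yx => ->; case: nbrG => _ []. Qed.

Lemma nbr_sym x y : (y \in nbr x) = (x \in nbr y).
Proof. by case: nbrG => _ [_]. Qed.

(** The jump changes the visits of [y] only; [low_but y] exempts [y], and [y] is not its own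
    neighbour, so both conditions survive with the roles of [x] and [y] exchanged. *)
Lemma trap_rcons p y (x := last x0 p) : p != [::] -> y \in nbr x ->
  low_but x p y -> low_but y p x ->
  trap (rcons p y) = hold (visits p x) * hold (visits p y).+1.
Proof.
move=> p0 yx ly lx; rewrite /trap /prev size_rcons /= last_rcons.
rewrite -cats1 take_size_cat // cats1 -/x ifT; last first.
  rewrite mem_rcons in_cons last_in // orbT nbr_sym yx /=.
  apply/andP; split; apply/allP => z zv.
    have := allP lx _ zv; case: eqVneq => //= zy.
    by rewrite visits_rcons_neq.
  have := allP ly _ zv; case: eqVneq => //= zx.
  by rewrite visits_rcons_neq // nbr_irr.
rewrite [in X in hold X * _]visits_rcons_neq; last by rewrite eq_sym nbr_irr.
by rewrite visits_rcons eqxx addn1.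
Qed.

Lemma low_weight p z : (visits p z < L)%N -> w (visits p z) <= \sum_(m < L) w m.
Proof.
move=> zL; rewrite (bigD1 (Ordinal zL)) //= lerDl.
by apply: sumr_ge0 => m _; exact: ltW.
Qed.

Lemma total_weight_low_but p y (x := last x0 p) : y \in nbr x ->
  low_but y p x -> total_weight p <= w (visits p y) + barrier.
Proof.
move=> yx lx; have ux : uniq (nbr x) by case: nbrG.
rewrite /total_weight -/x (bigD1_seq y) //= lerD2l.
apply: (@le_trans _ _ (\sum_(z <- nbr x) \sum_(m < L) w m)); last first.
  rewrite sumr_const_seq -mulr_natl ler_wpM2r ?ler_nat ?nbrD //.
  by apply: sumr_ge0 => m _; exact: ltW.
rewrite big_mkcond /= big_seq [leRHS]big_seq.
apply: ler_sum => z zx; case: ifPn => zy.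
  by apply: low_weight; have := allP lx _ zx; rewrite (negPf zy).
by apply: sumr_ge0 => m _; exact: ltW.
Qed.

(* [bold] jumps are the first kind of discovery of the header, [shy] ones the
   second. *)
Definition bold p y := (y \notin p) && ~~ low p (last x0 p).

Definition shy p y :=
  [&& y \notin p, low p (last x0 p) & low_but (last x0 p) p y].

(** * One-step drift of the three potentials *)

Definition growth p : R := (size (undup p) + frontier p)%:R.

Lemma growth_transition p : p != [::] ->
  transition growth p <= growth p + D.+1%:R *
    (\sum_(y <- nbr (last x0 p)) step p y * (shy p y)%:R +
     \sum_(y <- nbr (last x0 p)) step p y * (bold p y)%:R).
Proof.
move=> p0; rewrite -big_split mulr_sumr /transition.
rewrite -[X in X + _](sum_step_cst nbr w x0 w_gt0 nbr_nnil p).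
rewrite -big_split /= big_seq [leRHS]big_seq; apply: ler_sum => y yx.
rewrite -mulrDr mulrCA -mulrDr ler_wpM2l ?step_ge0 //.
rewrite /growth -natrD -natrM -natrD ler_nat.
apply: leq_trans (frontier_rcons _ _ p0 yx) _.
rewrite leq_add2l leq_mul2l /shy /bold.
by case: (y \notin p) => //; case: low => //; case: low_but.
Qed.

Lemma excess_transition p : transition excess p = excess p +
  \sum_(y <- nbr (last x0 p)) step p y *
    if (L <= visits p y)%N then (w (visits p y))^-1 else 0.
Proof.
rewrite -[X in X + _](sum_step_cst nbr w x0 w_gt0 nbr_nnil p) -big_split /=.
by apply: eq_bigr => y _; rewrite excess_rcons mulrDr.
Qed.

(* Seen from [x], a neighbour visited [m] times is chosen with probability
   [w m / S] and an unvisited one with probability [w 0 / S], for the same total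
   weight [S]; charging [1 / w m] to the former thus pays for the latter. *)
Lemma bold_transition p :
  \sum_(y <- nbr (last x0 p)) step p y * (bold p y)%:R <=
  D%:R * w 0 * (transition excess p - excess p).
Proof.
set x := last x0 p; rewrite excess_transition addrC addKr -/x.
have q0 y : 0 <= step p y *
    if (L <= visits p y)%N then (w (visits p y))^-1 else 0.
  by rewrite mulr_ge0 ?step_ge0 //; case: ifP => // _; rewrite invr_ge0 ltW.
have S0 := total_weight_gt0 nbr w x0 w_gt0 nbr_nnil p.
case: (boolP (low p x)) => [lx|].
  rewrite big1 => [|y _]; last by rewrite /bold lx andbF mulr0.
  by rewrite !mulr_ge0 ?sumr_ge0 // ltW.
move=> /allPn[z zx]; rewrite -leqNgt => Lz.
apply: (@le_trans _ _ (\sum_(y <- nbr x) w 0 / total_weight p)).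
  rewrite big_seq [leRHS]big_seq; apply: ler_sum => y yx.
  rewrite /bold; case: (boolP (_ && _)) => [/andP[yp _]|_].
    by rewrite mulr1 stepE // visits0.
  by rewrite mulr0 divr_ge0 // ltW.
rewrite sumr_const_seq -[leLHS]mulr_natl -mulrA.
apply: (@le_trans _ _ (D%:R * (w 0 / total_weight p))).
  by rewrite ler_wpM2r ?ler_nat ?nbrD // divr_ge0 // ltW.
rewrite ler_wpM2l // ler_wpM2l ?(ltW (w_gt0 0)) //.
rewrite (bigD1_seq z) //=; last first.
  by case: nbrG.
rewrite Lz stepE // mulrAC divff ?gt_eqF // mul1r lerDl.
exact: sumr_ge0.
Qed.

(** Jumping back to [prev p] preserves the trap on average by [hold_step], a shy jump creates a trap
    worth at least [hold 0 ^+ 2], and any other jump leaves a nonnegative value. *)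
Lemma trap_transition p : p != [::] ->
  trap p + hold 0 ^+ 2 * \sum_(y <- nbr (last x0 p)) step p y * (shy p y)%:R
  <= transition trap p.
Proof.
set x := last x0 p => p0.
have h0 n : 0 <= hold n by exact: ltW (hold_gt0 n).
have shyP y : y \in nbr x -> hold 0 ^+ 2 * (shy p y)%:R <= trap (rcons p y).
  move=> yx; case: (boolP (shy p y)) => [/and3P[_ lx ly]|_]; last first.
    by rewrite mulr0 trap_ge0.
  rewrite mulr1 trap_rcons // ?low_low_but // expr2.
  by apply: ler_pM; rewrite ?hold0_le.
rewrite [X in X + _]/trap -/x; case: ifP => [/and4P[yp yx ly lx]|_]; last first.
  rewrite add0r mulr_sumr big_seq [leRHS]big_seq; apply: ler_sum => y yx.
  by rewrite mulrCA ler_wpM2l ?step_ge0 // shyP.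
set y := prev p in yp yx ly lx *.
have ux : uniq (nbr x) by case: nbrG.
rewrite /transition (bigD1_seq y) //= -/x [in leRHS](bigD1_seq y) //=.
(* The visited [y] is not a shy target: its term pays for [trap p] alone, and the other neighbours
   pay for the shy jumps. *)
rewrite /shy yp /= mulr0 add0r; apply: lerD.
  rewrite trap_rcons // mulrCA [leLHS]mulrC ler_wpM2l //.
  apply: le_trans (hold_step _) _; rewrite ler_wpM2r // stepE //.
  rewrite ler_wpM2l ?(ltW (w_gt0 _)) //.
  rewrite lef_pV2 ?posrE ?total_weight_gt0 ?total_weight_low_but //.
  by rewrite ltr_wpDr ?barrier_ge0.
rewrite mulr_sumr [leLHS]big_seq_cond [leRHS]big_seq_cond.
apply: ler_sum => z /andP[zx _].
by rewrite mulrCA ler_wpM2l ?step_ge0 // shyP.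
Qed.

(** * Tail bound on the number of visited vertices *)

Hypothesis L_large : 2 * D.+1%:R * (D%:R * w 0) * tail L <= 1.

(** Markov's inequality for a supermartingale [G] dominating the number of visited vertices, with
    [M] its initial value. *)
Lemma range_tail : exists M : R, forall n K,
  1 - M / K.+1%:R <=
  iter n transition (fun p => (size (undup p) <= K)%N%:R) [:: x0].
Proof.
set b := 2 * D.+1%:R * (D%:R * w 0).
set c := 2 * D.+1%:R / hold 0 ^+ 2.
have c0 : 0 <= c by rewrite divr_ge0 ?mulr_ge0 ?exprn_ge0 // ltW ?hold_gt0.
have b0 : 0 <= b by rewrite !mulr_ge0 // ltW.
(* The coefficients [b] and [c] make the bold and shy terms cancel in the drift. Of the factor 2,
   one copy of the range absorbs [b * excess p] by [L_large] and one remains; the last [c] absorbs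
   [c * trap p]. *)
pose G p := 2 * growth p - b * excess p - c * trap p + c.
have RG p : (size (undup p))%:R <= G p.
  have : (size (undup p))%:R <= growth p by rewrite ler_nat leq_addr.
  have : b * excess p <= (size (undup p))%:R.
    apply: le_trans (ler_wpM2l b0 (excess_le p)) _.
    by rewrite mulrA ler_piMl.
  have : c * trap p <= c by rewrite ler_piMr // trap_le1.
  rewrite /G; lra.
exists (G [:: x0]) => n K.
have K0 : 0 < (K.+1%:R : R) by rewrite ltr0n.
pose f p := - 2 / K.+1%:R * growth p + b / K.+1%:R * excess p +
  c / K.+1%:R * trap p + (1 - c / K.+1%:R).
have fE p : f p = 1 - G p / K.+1%:R by rewrite /f /G; ring.
have f_le q : f q <= (size (undup q) <= K)%N%:R.
  rewrite fE; case: leqP => qK.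
    by rewrite gerBl divr_ge0 //; exact: le_trans (RG q).
  rewrite subr_le0 ler_pdivlMr // mul1r; apply: le_trans (RG q).
  by rewrite ler_nat.
rewrite -fE; apply: le_trans (ler_iter_transition nbr w x0 w_gt0 nbr_nnil
  n f _ [:: x0] isT (fun q _ => f_le q)).
apply: iter_transition_sub => // q q0.
rewrite transition_affine // -subr_ge0.
have gq := growth_transition q q0; have bq := bold_transition q.
have tq := trap_transition q q0.
set A := \sum_(y <- _) _ * (shy q y)%:R in gq tq.
set B := \sum_(y <- _) _ * (bold q y)%:R in gq bq.
have D0 : 0 <= 2 * D.+1%:R :> R by rewrite mulr_ge0.
have {}bq := ler_wpM2l D0 bq.
have {}tq := ler_wpM2l c0 tq.
have cA : c * (hold 0 ^+ 2 * A) = 2 * D.+1%:R * A.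
  by rewrite mulrA mulfVK // expf_neq0 // gt_eqF // hold_gt0.
rewrite mulrDr cA in tq; rewrite mulrA -/b in bq.
rewrite [leRHS](_ : _ = (2 * (growth q - transition growth q)
   + b * (transition excess q - excess q)
   + c * (transition trap q - trap q)) / K.+1%:R); last by rewrite /f; ring.
rewrite divr_ge0 //; lra.
Qed.

End Lyapunov.

(** * Finite ranges and finite disjoint unions *)

(** A prefix with the most distinct values contains the whole range: a missing value would give a
    longer prefix with more. *)
Lemma bounded_undup_finite_range (V : eqType) (f : nat -> V) (K : nat) :
  (forall n, size (undup (mkseq f n)) <= K)%N -> finite_set (range f).
Proof.
move=> fK; pose Q j := `[< exists n, size (undup (mkseq f n)) = j >].
have Q0 : exists j, Q j by exists 0%N; apply/asboolP; exists 0%N.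
have QK j : Q j -> (j <= K)%N by move=> /asboolP[n <-].
case: (ex_maxnP Q0 QK) => _ /asboolP[n <-] nmax.
apply: (@sub_finite_set _ _ [set` mkseq f n]); last exact: finite_seq.
move=> _ [m _ <-] /=; apply/negPn/negP => fm.
have fi i : (i < n)%N -> f i \in mkseq f (n + m.+1).
  by move=> ni; apply/mapP; exists i; rewrite ?mem_iota ?add0n //=; lia.
have /nmax : Q (size (undup (mkseq f (n + m.+1)))).
  by apply/asboolP; exists (n + m.+1)%N.
apply/negP; rewrite -ltnNge.
apply: (@uniq_leq_size _ (f m :: undup (mkseq f n))).
  by rewrite cons_uniq mem_undup fm undup_uniq.
move=> z; rewrite in_cons !mem_undup => /predU1P[->|/mapP[i]].
  by apply/mapP; exists m; rewrite ?mem_iota //=; lia.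
by rewrite mem_iota /= add0n => /fi ? ->.
Qed.

(* [bigcup_seq] is restricted to choice types. *)
Lemma bigsetU_seqE (I : eqType) (T : Type) (s : seq I) (A : I -> set T) :
  \big[setU/set0]_(i <- s) A i = \bigcup_(i in [set` s]) A i.
Proof.
elim: s => [|i s IH]; first by rewrite big_nil; apply/esym/bigcup0.
rewrite big_cons IH; apply/seteqP; split => [om [Ai|[j /= js Aj]]|om [j /=]].
- by exists i => //=; exact: mem_head.
- by exists j => //=; rewrite in_cons js orbT.
- by rewrite in_cons => /predU1P[->|js] Aj; [left|right; exists j].
Qed.

Lemma measure_bigsetU_seq (d : measure_display) (T : measurableType d)
    (R : realType) (mu : {measure set T -> \bar R}) (I : eqType) (s : seq I)
    (A : I -> set T) :
  uniq s -> (forall i, measurable (A i)) ->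
  (forall i j, i != j -> A i `&` A j = set0) ->
  mu (\big[setU/set0]_(i <- s) A i) = (\sum_(i <- s) mu (A i))%E.
Proof.
move=> us mA dA; elim: s us => [|i s IH] /=; first by rewrite !big_nil measure0.
move=> /andP[is_ us]; rewrite !big_cons measureU //.
- by congr (_ + _)%E; exact: IH.
- exact: bigsetU_measurable.
- rewrite big_distrr /= big_seq big1 // => j js.
  by apply: dA; apply: contraNneq is_ => ->.
Qed.

(** * From the transition operator to the law of the walk *)

Section Law.
Context {R : realType} {d : measure_display} {T : measurableType d}.
Context (P : probability T R) {V : eqType}.
Variables (nbr : V -> seq V) (w : nat -> R) (x0 : V) (X : nat -> T -> V).
Hypothesis nbrG : simple_graph nbr.
Hypothesis lawX : is_VRRW P nbr w x0 X.
Implicit Types (p : seq V) (S : pred (seq V)).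

Local Notation step := (vrrw_step nbr w x0).
Local Notation path_prob := (vrrw_path_prob nbr w x0).
Local Notation transition := (transition nbr w x0).

Definition cylinder p : set T :=
  [set om | forall k, (k < size p)%N -> X k om = nth x0 p k].

Lemma measurable_cylinder p : measurable (cylinder p).
Proof.
rewrite (_ : cylinder p =
    \bigcap_(k in `I_(size p)) [set om | X k om = nth x0 p k]) //.
by apply: fin_bigcap_measurable => // k _; exact: lawX.1.
Qed.

Lemma path_prob_rcons p y : p != [::] ->
  path_prob (rcons p y) = path_prob p * step p y.
Proof.
move=> p0; rewrite /vrrw_path_prob size_rcons big_nat_recr /=; last first.
  by rewrite lt0n size_eq0.
rewrite -mulrA; congr (_ * _); first by case: p p0.
congr (_ * _); last by rewrite nth_rcons ltnn eqxx -cats1 take_size_cat.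
apply: eq_big_nat => k /andP[_ kp].
by rewrite nth_rcons kp -cats1 takel_cat // ltnW.
Qed.

Lemma cylinder_rcons_sub p y : cylinder (rcons p y) `<=` cylinder p.
Proof.
move=> om H k kp; rewrite H ?size_rcons 1?ltnW ?ltnS //.
by rewrite nth_rcons kp.
Qed.

Lemma cylinder_rcons_last p y om : cylinder (rcons p y) om ->
  X (size p) om = y.
Proof. by move=> ->; rewrite ?size_rcons // nth_rcons ltnn eqxx. Qed.

(** The paths that start with [p], then follow [n] edges and end with a history in [S]. Branching
    over neighbours keeps the unions finite, hence measurable for any [V]. *)
Fixpoint reach S n p : set T :=
  if n is n'.+1 then
    \big[setU/set0]_(y <- nbr (last x0 p)) reach S n' (rcons p y)
  else if S p then cylinder p else set0.

Lemma measurable_reach S n p : measurable (reach S n p).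
Proof.
elim: n p => [|n IH] p /=; last exact: bigsetU_measurable.
by case: ifP => // _; exact: measurable_cylinder.
Qed.

Lemma reach_sub_cylinder S n p : reach S n p `<=` cylinder p.
Proof.
elim: n p => [|n IH] p /=; first by move=> om; case: ifP.
rewrite bigsetU_seqE; apply: bigcup_sub => y _.
exact: subset_trans (IH _) (@cylinder_rcons_sub _ _).
Qed.

(** The branches are disjoint, since [X (size p)] tells them apart, so their probabilities add
    up. *)
Lemma prob_reach S n p : p != [::] -> P (reach S n p) =
  (path_prob p * iter n transition (fun q => (S q)%:R) p)%:E.
Proof.
elim: n p => [|n IH] p p0 /=.
  case: ifP => _; last by rewrite measure0 mulr0.
  by rewrite mulr1; exact: lawX.2.
rewrite measure_bigsetU_seq; last first.
- move=> y z /eqP yz; apply/seteqP; split => // om.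
  move=> [/reach_sub_cylinder/cylinder_rcons_last Xy].
  by move=> /reach_sub_cylinder/cylinder_rcons_last Xz; case: yz; rewrite -Xy.
- by move=> y; exact: measurable_reach.
- by case: nbrG.
rewrite /transition mulr_sumr -sumEFin; apply: eq_bigr => y _.
apply: etrans (IH _ _) _; first by rewrite -size_eq0 size_rcons.
by rewrite path_prob_rcons // mulrA.
Qed.

Lemma reachS_sub S n p : (forall q y, S (rcons q y) -> S q) ->
  reach S n.+1 p `<=` reach S n p.
Proof.
move=> Sp; elim: n p => [|n IH] p.
  rewrite /= bigsetU_seqE; apply: bigcup_sub => y _.
  move=> om; case: ifP => // Spy.
  by rewrite (Sp _ _ Spy) => /cylinder_rcons_sub.
rewrite [reach S n.+2 p]/= [reach S n.+1 p]/= !bigsetU_seqE.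
by apply: subset_bigcup => y _; exact: IH.
Qed.

Lemma reach_mkseq S n p om : reach S n p om ->
  S (mkseq (X ^~ om) (size p + n)).
Proof.
elim: n p => [|n IH] p /=.
  case: ifP => // Sp pom; rewrite addn0.
  suff -> : mkseq (X ^~ om) (size p) = p by [].
  apply: (@eq_from_nth _ x0); rewrite size_mkseq // => i ip.
  by rewrite nth_mkseq // pom.
rewrite bigsetU_seqE => -[y _ /IH].
by rewrite size_rcons addSnnS.
Qed.

(** The events of seeing more than [K] vertices increase with time, so continuity from below bounds
    their union by [M / K.+1]; the intersection over [K] is null. *)
Lemma ae_finite_range (M : R) :
  (forall n K, 1 - M / K.+1%:R <=
    iter n transition (fun p => (size (undup p) <= K)%N%:R) [:: x0]) ->
  {ae P, forall om, finite_set (range (fun n => X n om))}.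
Proof.
move=> tailM; pose S K p := (size (undup p) <= K)%N.
pose E K n := ~` reach (S K) n [:: x0].
have mE K n : measurable (E K n) by apply: measurableC; exact: measurable_reach.
have mEU K : measurable (\bigcup_n E K n) by exact: bigcup_measurable.
have PE K n : (P (E K n) <= (M / K.+1%:R)%:E)%E.
  rewrite probability_setC; last exact: measurable_reach.
  rewrite prob_reach // /vrrw_path_prob /= eqxx big_geq // !mul1r.
  by rewrite -EFinB lee_fin lerBlDr -lerBlDl; exact: tailM.
have PEU K : (P (\bigcup_n E K n) <= (M / K.+1%:R)%:E)%E.
  apply: (@cvge_le _ \oo _ _ (P \o E K)); first by apply: nearW => n; exact: PE.
  apply: nondecreasing_cvg_mu => //.
  apply/nondecreasing_seqP => n; apply/subsetPset/subsetC/reachS_sub.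
  move=> q y; apply: leq_trans; rewrite size_undup_rcons; exact: leq_addr.
exists (\bigcap_K \bigcup_n E K n); split.
- exact: bigcap_measurable.
- apply/eqP; rewrite eq_le measure_ge0 andbT.
  apply/lee_addgt0Pr => e e0; rewrite add0e.
  pose K := Num.trunc (M / e).
  apply: (@le_trans _ _ (M / K.+1%:R)%:E).
    apply: le_trans (PEU K); apply: le_measure; rewrite ?inE //.
      exact: bigcap_measurable.
    exact: bigcap_inf.
  rewrite lee_fin ler_pdivrMr // mulrC -ler_pdivrMr //.
  exact/ltW/truncnS_gt.
- move=> om; apply: contra_notP => /existsNP[K] /not_implyP[_ EK].
  apply: (@bounded_undup_finite_range _ _ K) => n.
  have : reach (S K) n [:: x0] om.
    by apply: contrapT => H; apply: EK; exists n.
  (* After [n] jumps the history has [n.+1] entries, one more than the prefix to be bounded. *)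
  move=> /reach_mkseq; rewrite add1n; apply: leq_trans.
  apply: uniq_leq_size; rewrite ?undup_uniq // => z; rewrite !mem_undup.
  case/mapP => i im ->; apply/mapP; exists i => //.
  by move: im; rewrite !mem_iota; lia.
Qed.

End Law.

Theorem theorem5p1 (R : realType) (d : measure_display) (T : measurableType d)
    (P : probability T R) (V : eqType) (nbr : V -> seq V) (w : nat -> R)
    (x0 : V) (X : nat -> T -> V) :
  simple_graph nbr -> no_isolated nbr -> bounded_degree nbr ->
  (forall n, 0 < w n) ->
  cvgn (series (fun n => (w n)^-1)) ->
  is_VRRW P nbr w x0 X ->
  {ae P, forall om, finite_set (range (fun n => X n om))}.
Proof.
move=> nbrG nbr_nnil [D nbrD] w_gt0 w_cvg lawX.
have tail0 : tail w n @[n --> \oo] --> (0 : R).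
  rewrite -[X in _ --> X](subrr (limn (series (fun n => (w n)^-1)))).
  by apply: cvgB => //; exact: cvg_cst.
pose b := 2 * D.+1%:R * (D%:R * w 0).
have [L L_gt0 L_large] : exists2 L, (0 < L)%N & b * tail w L <= 1.
  have bt : b * tail w n @[n --> \oo] --> (0 : R).
    by rewrite -(mulr0 b); apply: cvgM => //; exact: cvg_cst.
  have := cvgr_le 0 bt 1 ltr01; case => N _ NL.
  (* The successor makes the threshold positive. *)
  by exists N.+1 => //; apply: NL => /=.
have [M rangeM] := range_tail nbr w x0 D L nbrG nbr_nnil nbrD w_gt0 w_cvg
  L_gt0 L_large.
exact: ae_finite_range nbrG lawX _ rangeM.
Qed.
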